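(* Let $G$ be a finite nonempty $\delta$-regular simple graph with $\delta>0$, and let $\mathcal{L}(G)$ be its line graph. For every integer $k\in\{2(1-\delta),\dots,0\}$, $$a_k(\mathcal{L}(G))=\delta+\left\lceil\frac{k}{2}\right\rceil .$$
   Context: The line graph $\mathcal{L}(G)$ has the edges of $G$ as vertices, two being adjacent when they are distinct edges sharing an endpoint. For a graph $H$ with vertex set $W$, a set $X\subseteq W$ and $w\in W$, $\delta_X(w)$ denotes the number of neighbors of $w$ in $X$, and $\bar S=W\setminus S$. For an integer $k$, a nonempty set $S\subseteq W$ is a defensive $k$-alliance in $H$ if $\delta_S(w)\ge \delta_{\bar S}(w)+k$ for every $w\in S$. The defensive $k$-alliance number $a_k(H)$ is the minimum cardinality of a defensive $k$-alliance in $H$. *)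

(* Defs.v *)
From HB Require Import structures.
From mathcomp Require Import all_boot all_order all_algebra.

Set Implicit Arguments.
Unset Strict Implicit.
Unset Printing Implicit Defensive.

Import Order.TTheory GRing.Theory Num.Theory.
Local Open Scope ring_scope.

Record sgraph := SGraph {
  svertex :> finType;
  sadj : rel svertex;
  sadj_sym : symmetric sadj;
  sadj_irr : irreflexive sadj
}.

Definition degree_in (H : sgraph) (X : {set H}) (w : H) : nat :=
  #|[set v in X | sadj w v]|.

Definition regular (H : sgraph) (d : nat) : Prop :=
  forall v : H, degree_in [set: H] v = d.

Definition edges (G : sgraph) : {set {set G}} :=
  [set [set p.1; p.2] | p : G * G & sadj p.1 p.2].

Definition line_adj (G : sgraph) : rel {A : {set G} | A \in edges G} :=
  fun A B => (A != B) && (val A :&: val B != set0).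

Lemma line_adj_sym (G : sgraph) : symmetric (@line_adj G).
Proof. by move=> A B; rewrite /line_adj eq_sym setIC. Qed.

Lemma line_adj_irr (G : sgraph) : irreflexive (@line_adj G).
Proof. by move=> A; rewrite /line_adj eqxx. Qed.

Definition line_graph (G : sgraph) : sgraph :=
  SGraph (@line_adj_sym G) (@line_adj_irr G).

Definition defensive_alliance (H : sgraph) (k : int) (S : {set H}) : bool :=
  (S != set0) &&
  [forall w in S, (degree_in S w)%:Z >= (degree_in (~: S) w)%:Z + k].

(* The value is 0 when H has no defensive k-alliance; as alliances are
   nonempty, a positive value is always the size of an actual alliance. *)
Definition alliance_number (H : sgraph) (k : int) : nat :=
  if [pick S : {set H} | defensive_alliance k S] is Some S0
  then #|[arg min_(S < S0 | defensive_alliance k S) #|S|]|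
  else 0%N.

(* Main.v *)
Require Import Defs.
From mathcomp Require Import all_boot all_order all_algebra.
From mathcomp Require Import zify.

Import Order.TTheory GRing.Theory Num.Theory.
Local Open Scope ring_scope.

(** In an [r]-regular graph the degree of a vertex inside [S] determines its
    degree outside [S], so a defensive [k]-alliance is a nonempty set in which
    every vertex has at least [(r + k) / 2] neighbours ([allianceE]).

    The edges of a [d]-regular graph [G] through a given vertex form a star of
    [d] edges, which is a clique of the line graph.  The neighbours of an edge
    [uv] are the edges other than [uv] in the stars at [u] and [v], and these
    stars share only [uv]; hence the line graph is [2 (d - 1)]-regular
    ([line_graph_regular]), and an alliance is a nonempty set in which every
    vertex has at least [s - 1] neighbours, where [s = d + ceil (k / 2)].
    Such a set has at least [s] elements: a vertex and its neighbours.
    Conversely, since [1 <= s <= d], any [s] edges of one star form a clique of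
    size [s] in the line graph, so the bound is attained. *)

Lemma degree_in_setC (H : sgraph) (r : nat) (S : {set H}) (w : H) :
  regular H r -> (degree_in S w + degree_in (~: S) w)%N = r.
Proof.
move=> /(_ w) <-; rewrite /degree_in.
rewrite -(cardsID S [set v in [set: H] | sadj w v]).
by congr (_ + _)%N; apply: eq_card => v; rewrite !inE andbC.
Qed.

Lemma allianceE (H : sgraph) (r : nat) (k : int) (S : {set H}) :
  regular H r ->
  defensive_alliance k S =
    (S != set0) && [forall w in S, r%:Z + k <= 2 * (degree_in S w)%:Z].
Proof.
move=> Hreg; congr (_ && _); apply: eq_forallb => w; congr (_ ==> _).
by have := degree_in_setC _ _ S w Hreg; lia.
Qed.

(** A vertex is not its own neighbour. *)
Lemma degree_in_lt (H : sgraph) (S : {set H}) (w : H) :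
  w \in S -> (degree_in S w < #|S|)%N.
Proof.
move=> wS; apply: proper_card; apply/properP; split.
  by apply/subsetP=> v; rewrite inE => /andP[].
by exists w; rewrite // inE sadj_irr andbF.
Qed.

Lemma alliance_number_eq (H : sgraph) (k : int) (S : {set H}) :
  defensive_alliance k S ->
  (forall T : {set H}, defensive_alliance k T -> (#|S| <= #|T|)%N) ->
  alliance_number H k = #|S|.
Proof.
move=> allS minS; rewrite /alliance_number.
case: pickP => [S0 allS0 | /(_ S)]; last by rewrite allS.
case: arg_minnP => // T allT minT.
by apply/eqP; rewrite eqn_leq minT // minS.
Qed.

Definition star {G : sgraph} (v : G) : {set line_graph G} :=
  [set e : line_graph G | v \in val e].

Lemma edgeP (G : sgraph) (A : {set G}) :
  reflect (exists u v : G, sadj u v /\ A = [set u; v]) (A \in edges G).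
Proof.
apply: (iffP imsetP) => [[[u v]] | [u [v [uv ->]]]].
  by rewrite inE /= => uv ->; exists u, v.
by exists (u, v); rewrite ?inE.
Qed.

(** Edges through [v] correspond to neighbours of [v], by sending [w] to the
    pair [{v, w}]. *)
Lemma card_star (G : sgraph) (v : G) :
  #|star v| = degree_in [set: G] v.
Proof.
have pair_inj : {in [set w in [set: G] | sadj v w] &,
    injective (fun w : G => [set v; w])}.
  move=> w x; rewrite !inE /= => vw vx /setP/(_ w).
  rewrite !inE eqxx orbT => /esym/orP[/eqP wv | /eqP //].
  by rewrite wv sadj_irr in vw.
rewrite /degree_in -(card_in_imset pair_inj) -(card_imset _ val_inj).
apply: eq_card => A; apply/imsetP/imsetP=> [[e + ->] | [w + ->]].
  have /edgeP[x [y [xy eE]]] := valP e; rewrite inE eE !inE.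
  case/orP=> /eqP ->; first by exists y; rewrite ?inE.
  by exists x; rewrite ?inE 1?sadj_sym // setUC.
rewrite !inE /= => vw.
have vwE : [set v; w] \in edges G by apply/edgeP; exists v, w.
by exists (exist (fun A => A \in edges G) _ vwE); rewrite ?inE ?eqxx.
Qed.

Lemma star_adj (G : sgraph) (v : G) (e f : line_graph G) :
  e \in star v -> f \in star v -> sadj e f = (e != f).
Proof.
rewrite !inE => ve vf; rewrite /= /line_adj; case: eqP => //= _.
by apply/set0Pn; exists v; rewrite inE ve.
Qed.

Lemma degree_in_star (G : sgraph) (v : G) (S : {set line_graph G})
    (e : line_graph G) :
  S \subset star v -> e \in S -> (degree_in S e).+1 = #|S|.
Proof.
move=> /subsetP sS eS; rewrite (cardsD1 e S) eS add1n; congr _.+1.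
apply: eq_card => f; rewrite !inE; case fS: (f \in S); last by rewrite andbF.
by rewrite (star_adj _ _ _ _ (sS _ eS) (sS _ fS)) eq_sym andbT.
Qed.

Lemma line_graph_regular (G : sgraph) (d : nat) :
  regular G d -> regular (line_graph G) (2 * d.-1).
Proof.
move=> hreg e; have /edgeP[u [v [uv eE]]] := valP e.
have u_e : e \in star u by rewrite inE eE !inE eqxx.
have v_e : e \in star v by rewrite inE eE !inE eqxx orbT.
have nbrs : degree_in [set: line_graph G] e = #|(star u :|: star v) :\ e|.
  apply: eq_card => f; rewrite !inE /= /line_adj eq_sym; congr (_ && _).
  apply/set0Pn/orP => [[x] | [uf | vf]].
  - rewrite eE !inE => /andP[/orP[] /eqP -> xf]; by [left | right].
  - by exists u; rewrite inE eE !inE eqxx.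
  - by exists v; rewrite inE eE !inE eqxx orbT.
have starI : star u :&: star v = [set e].
  apply/setP=> f; rewrite !inE; apply/andP/eqP => [[uf vf] | ->]; last first.
    by rewrite eE !inE !eqxx orbT.
  (* An edge containing the distinct vertices u and v is the pair {u, v}. *)
  apply: val_inj; rewrite eE; apply/esym/eqP.
  rewrite eqEcard subUset !sub1set uf vf /=.
  have /edgeP[x [y [_ ->]]] := valP f.
  have -> : #|[set u; v]| = 2.
    by rewrite cards2; case: eqP uv => // ->; rewrite sadj_irr.
  by rewrite cards2; case: (_ != _).
have := cardsUI (star u) (star v).
have := cardsD1 e (star u :|: star v).
rewrite nbrs inE u_e starI cards1 !card_star !hreg /=.
lia.
Qed.

Theorem corollary11 (G : sgraph) (d : nat) (k : int)
    (hG : (0 < #|G|)%N) (hd : (0 < d)%N) (hreg : regular G d)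
    (hk : 2 * (1 - d%:Z) <= k <= 0) :
  (alliance_number (line_graph G) k)%:Z = d%:Z + Num.ceil (k%:Q / 2).
Proof.
set c := Num.ceil _.
have cE (n : int) : (c <= n) = (k <= 2 * n).
  rewrite /c ceil_le_int ler_pdivrMr // mulrC.
  by rewrite -[X in X * _]/(2%:~R) -intrM ler_int.
have [c_ge c_le] : 1 <= d%:Z + c /\ c <= 0.
  by split; [have := cE c; rewrite lexx | rewrite cE]; lia.
have [s sE] : exists s : nat, s%:Z = d%:Z + c by exists (absz (d%:Z + c)); lia.
have Lreg := line_graph_regular _ _ hreg.
have degE (n : nat) : ((2 * d.-1)%:Z + k <= 2 * n%:Z) = (s <= n.+1)%N.
  by have := cE (n%:Z + 1 - d%:Z); lia.
have [v _] := card_gt0P hG.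
have [S sS cardS] : exists2 S : {set line_graph G}, S \subset star v & #|S| = s.
  have : (s <= #|star v|)%N by rewrite card_star hreg; lia.
  rewrite -bin_gt0 -cards_draws => /card_gt0P[S].
  by rewrite inE => /andP[sS /eqP]; exists S.
rewrite -sE -cardS; congr Posz; apply: alliance_number_eq.
  rewrite (allianceE _ _ _ _ Lreg) -card_gt0 cardS; apply/andP; split; first lia.
  by apply/forall_inP => e eS; rewrite degE (degree_in_star _ _ _ _ sS eS) cardS.
move=> T; rewrite (allianceE _ _ _ _ Lreg) => /andP[/set0Pn[e eT]].
move=> /forall_inP/(_ e eT); rewrite degE cardS => /leq_trans -> //.
exact: degree_in_lt.
Qed.
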